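(* Let $b,c$ be real numbers with $b\ge \max\{c,2c-1\}>0$, let $\mu\in[-1,1]$, and let $n\ge 0$ be an integer. With $f_\mu(z)=\frac{1}{(1-z)^{\mu}}$, one has the subordination $$(1-z)^{\mu}\,\sigma_n^{(b-1,c)}(f_{\mu},z)\prec (1-z)^{\mu}\qquad (z\in\mathbb{D}).$$
   Context: $\mathbb{D}=\{z\in\mathbb{C}:|z|<1\}$. $(x)_0=1$, $(x)_k=x(x+1)\cdots(x+k-1)$. Put $B_0=1$ and $B_k=\frac{(b)_k}{(c)_k}\cdot\frac{1+b-c}{b}$ for $k\ge1$. For $f(z)=\sum_{k\ge0}a_kz^k$ analytic in $\mathbb{D}$ with $f(0)=1$, the $n$th Cesàro mean of type $(b-1;c)$ of $f$ is $\sigma_n^{(b-1,c)}(f,z)=\frac1{B_n}\sum_{k=0}^n B_{n-k}a_kz^k$. Powers of $1-z$ are principal branches (value $1$ at $z=0$). For analytic $f,g$ in $\mathbb{D}$, $f\prec g$ means there is an analytic $\omega:\mathbb{D}\to\mathbb{D}$ with $|\omega(z)|\le|z|$ and $f(z)=g(\omega(z))$ for all $z\in\mathbb{D}$. *)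

(* Defs.v *)
From Stdlib Require Import Reals.
From Coquelicot Require Import Coquelicot.

Open Scope R_scope.

Definition in_disk (z : C) : Prop := Cmod z < 1.

(* Complex differentiability at every point of the open unit disk. *)
Definition analytic_on_disk (f : C -> C) : Prop :=
  forall z : C, in_disk z -> ex_derive (K := C_AbsRing) (V := C_NormedModule) f z.

(* The half-angle formula gives the principal argument, in (-PI, PI), for w off
   the half-line (-oo, 0]; the value on that half-line is a junk value. *)
Definition Carg (w : C) : R := 2 * atan (Im w / (Cmod w + Re w)).

Definition Clog (w : C) : C := (ln (Cmod w), Carg w).

Definition Cexp (z : C) : C := (exp (Re z) * cos (Im z), exp (Re z) * sin (Im z)).

(* Principal branch of w^a; only meaningful for w off (-oo, 0], which contains
   all points 1 - z with |z| < 1. *)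
Definition Cpower (w : C) (a : R) : C := Cexp (RtoC a * Clog w)%C.

Fixpoint pochhammer (x : R) (k : nat) : R :=
  match k with
  | O => 1
  | S k' => pochhammer x k' * (x + INR k')
  end.

Definition cesaro_B (b c : R) (k : nat) : R :=
  match k with
  | O => 1
  | S _ => pochhammer b k / pochhammer c k * ((1 + b - c) / b)
  end.

Definition power_series_on_disk (a : nat -> C) (f : C -> C) : Prop :=
  forall z : C, in_disk z ->
    is_pseries (K := C_AbsRing) (V := C_NormedModule) a z (f z).

(* The n-th mean of type (b - 1; c) of the function with Taylor coefficients a
   at 0; sum_n u n has the n + 1 terms u 0, ..., u n. *)
Definition cesaro_mean (b c : R) (n : nat) (a : nat -> C) (z : C) : C :=
  (/ RtoC (cesaro_B b c n) *
   sum_n (fun k : nat => RtoC (cesaro_B b c (n - k)) * a k * z ^ k) n)%C.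

Definition subordinate (f g : C -> C) : Prop :=
  exists omega : C -> C,
    analytic_on_disk omega /\
    (forall z : C, in_disk z -> in_disk (omega z)) /\
    (forall z : C, in_disk z -> Cmod (omega z) <= Cmod z) /\
    (forall z : C, in_disk z -> f z = g (omega z)).

Definition f_mu (mu : R) (z : C) : C := (1 / Cpower (1 - z) mu)%C.

(* Main.v *)
Require Import Defs.
From Stdlib Require Import Reals.
From Coquelicot Require Import Coquelicot.
From Stdlib Require Import Lra Lia Ranalysis5.

(** The mean is a polynomial [s] with coefficients [lambda_k a_k], where [a_k]
    are the Taylor coefficients of [(1 - z)^(- mu)] and the weights
    [lambda_k = B_(n-k) / B_n] are nonincreasing and start at [1]; this is where
    [b >= c] and [b >= 2 c - 1] enter.  For [mu = 0] both functions are constant.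
    Otherwise the Schwarz function can only be
    [omega = 1 - (1 - z) s^(1/mu)], and the point is that its derivative factors:

      [omega' = s^(1/mu - 1) p],   [p = s - (1 - z) s' / mu].

    From [(k + 1) a_(k+1) = (mu + k) a_k], the coefficients of [mu p] are
    [(mu + k) a_k (lambda_k - lambda_(k+1))], so for [-1 <= mu <= 1] those of [p]
    are nonnegative.  If [mu > 0], then [s] has nonnegative coefficients and
    [1/mu - 1 >= 0]; if [mu < 0], then [1 - s] has nonnegative coefficients and
    [1/mu - 1 < 0].  In both cases [|omega' z| <= omega' |z|].  Integrating along
    the radius,

      [|omega z| <= omega |z| = 1 - (1 - r) s(r)^(1/mu) <= r],   [r = |z|],

    where the last inequality is [s r >= 1] for [mu > 0] and [s r <= 1] for
    [mu < 0].  This is [subordinate_Cpoly_of_log], which rests on the growth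
    comparison [Cmod_increment_le] and on [subordinate_of_log].

    The power [s^(1/mu)] needs an analytic logarithm of [s] on the disk.  It is
    built from the principal logarithm, applied to [s] when [mu < 0]
    ([subordinate_Cpoly_neg]) and to [(1 - z) s] when [mu > 0]
    ([subordinate_Cpoly_pos]); these stay in the right half-plane.  That the
    principal branch of [(1 - omega)^mu] is the right one follows by continuity
    along rays, in [subordinate_of_log]. *)

Open Scope R_scope.

(** * Complex differentiation *)

Notation is_Cderive :=
  (is_derive (K := C_AbsRing) (V := C_NormedModule)).

Lemma is_Cderive_eps_delta (f : C -> C) (z l : C) :
  is_Cderive f z l <->
  forall eps : posreal, exists delta : posreal, forall w : C,
    Cmod (w - z) < delta ->
    Cmod (f w - f z - (w - z) * l) <= eps * Cmod (w - z).
Proof.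
split.
- intros [_ H] eps.
  destruct (H z (fun P HP => HP) eps) as [delta Hd].
  exists delta; intros w Hw; apply (Hd w Hw).
- intros H; split; [apply is_linear_scal_l|].
  intros x Hx.
  rewrite <- (is_filter_lim_locally_unique (V := AbsRing_NormedModule C_AbsRing) z x Hx).
  intros eps; destruct (H eps) as [delta Hd].
  exists delta; intros w Hw; apply (Hd w Hw).
Qed.

(** [C] is a normed module over itself in two ways, with equal norms but
    different uniform structures; the product and chain rules are stated for
    the one that comes from the ring. *)
Lemma is_Cderive_AbsRing (f : C -> C) (z l : C) :
  is_derive (K := C_AbsRing) (V := AbsRing_NormedModule C_AbsRing) f z l <->
  is_Cderive f z l.
Proof.
split; intros [_ H]; split;
  solve [apply is_linear_scal_l | exact H].
Qed.

Lemma is_Cderive_const (k z : C) : is_Cderive (fun _ => k) z (RtoC 0).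
Proof. exact (is_derive_const (K := C_AbsRing) (V := C_NormedModule) k z). Qed.

Lemma is_Cderive_id (z : C) : is_Cderive (fun w => w) z (RtoC 1).
Proof. apply is_Cderive_AbsRing; exact (is_derive_id (K := C_AbsRing) z). Qed.

Lemma is_Cderive_plus (f g : C -> C) (z df dg : C) :
  is_Cderive f z df -> is_Cderive g z dg ->
  is_Cderive (fun w => f w + g w)%C z (df + dg)%C.
Proof. apply (is_derive_plus (K := C_AbsRing) (V := C_NormedModule)). Qed.

Lemma is_Cderive_minus (f g : C -> C) (z df dg : C) :
  is_Cderive f z df -> is_Cderive g z dg ->
  is_Cderive (fun w => f w - g w)%C z (df - dg)%C.
Proof. apply (is_derive_minus (K := C_AbsRing) (V := C_NormedModule)). Qed.

Lemma is_Cderive_mult (f g : C -> C) (z df dg : C) :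
  is_Cderive f z df -> is_Cderive g z dg ->
  is_Cderive (fun w => f w * g w)%C z (df * g z + f z * dg)%C.
Proof.
rewrite <- !is_Cderive_AbsRing; intros Hf Hg.
exact (is_derive_mult (K := C_AbsRing) f g z df dg Hf Hg Cmult_comm).
Qed.

Lemma is_Cderive_comp (f g : C -> C) (z df dg : C) :
  is_Cderive f (g z) df -> is_Cderive g z dg ->
  is_Cderive (fun w => f (g w)) z (dg * df)%C.
Proof.
rewrite <- (is_Cderive_AbsRing g); intros Hf Hg.
exact (is_derive_comp (K := C_AbsRing) (V := C_NormedModule) f g z df dg Hf Hg).
Qed.

Lemma is_Cderive_eq (f g : C -> C) (z l m : C) :
  is_Cderive f z l -> (forall w, f w = g w) -> l = m -> is_Cderive g z m.
Proof.
intros Hf Hfg <-.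
exact (is_derive_ext (K := C_AbsRing) (V := C_NormedModule) f g z l Hfg Hf).
Qed.

Lemma is_Cderive_one_minus (z : C) : is_Cderive (fun w => 1 - w)%C z (- (1))%C.
Proof.
eapply is_Cderive_eq;
  [apply is_Cderive_minus; [apply is_Cderive_const|apply is_Cderive_id]
  |reflexivity|ring].
Qed.

(** * Exponential and logarithm on the right half-plane *)

Lemma diff2_fst (x y : R) : differentiable_pt_lim (fun u _ => u) x y 1 0.
Proof. apply (differentiable_pt_lim_proj1_0 (fun u => u)), derivable_pt_lim_id. Qed.

Lemma diff2_snd (x y : R) : differentiable_pt_lim (fun _ v => v) x y 0 1.
Proof.
intros eps; exists eps; intros u v _ _.
replace (v - y - (0 * (u - x) + 1 * (v - y))) with 0 by ring.
rewrite Rabs_R0.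
apply Rmult_le_pos; [apply Rlt_le, cond_pos|].
eapply Rle_trans; [apply Rabs_pos|apply Rmax_l].
Qed.

Lemma diff2_eq (f : R -> R -> R) (x y a b a' b' : R) :
  differentiable_pt_lim f x y a b -> a = a' -> b = b' ->
  differentiable_pt_lim f x y a' b'.
Proof. now intros H <- <-. Qed.

Lemma diff2_comp (g : R -> R) (f : R -> R -> R) (x y l a b : R) :
  derivable_pt_lim g (f x y) l -> differentiable_pt_lim f x y a b ->
  differentiable_pt_lim (fun u v => g (f u v)) x y (l * a) (l * b).
Proof.
intros Hg Hf.
eapply diff2_eq.
- apply (differentiable_pt_lim_comp (fun u _ => g u) f f);
    [apply differentiable_pt_lim_proj1_0, Hg|exact Hf|exact Hf].
- ring.
- ring.
Qed.

Lemma diff2_plus (f g : R -> R -> R) (x y a b a' b' : R) :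
  differentiable_pt_lim f x y a b -> differentiable_pt_lim g x y a' b' ->
  differentiable_pt_lim (fun u v => f u v + g u v) x y (a + a') (b + b').
Proof.
intros Hf Hg.
assert (Hp : differentiable_pt_lim Rplus (f x y) (g x y) 1 1).
{ intros eps; exists eps; intros u v _ _.
  match goal with |- Rabs ?e <= _ => replace e with 0 by ring end.
  rewrite Rabs_R0.
  apply Rmult_le_pos; [apply Rlt_le, cond_pos|].
  eapply Rle_trans; [apply Rabs_pos|apply Rmax_l]. }
eapply diff2_eq.
- apply (differentiable_pt_lim_comp Rplus f g _ _ _ _ _ _ _ _ Hp Hf Hg).
- ring.
- ring.
Qed.

Lemma diff2_mult (f g : R -> R -> R) (x y a b a' b' : R) :
  differentiable_pt_lim f x y a b -> differentiable_pt_lim g x y a' b' ->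
  differentiable_pt_lim (fun u v => f u v * g u v) x y
    (a * g x y + f x y * a') (b * g x y + f x y * b').
Proof.
intros Hf Hg.
assert (Hp : differentiable_pt_lim Rmult (f x y) (g x y) (g x y) (f x y)).
{ set (p := f x y); set (q := g x y).
  intros eps; exists eps; intros u v Hu Hv.
  match goal with |- Rabs ?e <= _ =>
    replace e with ((u - p) * (v - q)) by ring end.
  rewrite Rabs_mult.
  apply Rmult_le_compat; [apply Rabs_pos|apply Rabs_pos|now apply Rlt_le|].
  apply Rmax_r. }
eapply diff2_eq.
- apply (differentiable_pt_lim_comp Rmult f g _ _ _ _ _ _ _ _ Hp Hf Hg).
- ring.
- ring.
Qed.

(** Total differentiability of both components makes the remainder [o(|h|)],
    and the Cauchy-Riemann equations say that the differential is
    multiplication by a complex number. *)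
Lemma is_Cderive_Cauchy_Riemann (U V : R -> R -> R) (z : C) (a b : R) :
  differentiable_pt_lim U (Re z) (Im z) a (- b) ->
  differentiable_pt_lim V (Re z) (Im z) b a ->
  is_Cderive (fun w => (U (Re w) (Im w), V (Re w) (Im w))) z (a, b).
Proof.
intros HU HV; apply is_Cderive_eps_delta; intros eps.
destruct (HU (pos_div_2 eps)) as [d1 H1].
destruct (HV (pos_div_2 eps)) as [d2 H2].
assert (Hd : 0 < Rmin d1 d2) by (apply Rmin_pos; apply cond_pos).
exists (mkposreal _ Hd); intros w Hw; simpl in Hw.
assert (Hm := Rmax_Cmod (w - z)%C).
assert (Hre : fst (w - z)%C = Re w - Re z) by reflexivity.
assert (Him : snd (w - z)%C = Im w - Im z) by reflexivity.
rewrite Hre, Him in Hm.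
assert (HA : Rabs (Re w - Re z) < Rmin d1 d2)
  by (eapply Rle_lt_trans; [|exact Hw]; eapply Rle_trans; [apply Rmax_l|exact Hm]).
assert (HB : Rabs (Im w - Im z) < Rmin d1 d2)
  by (eapply Rle_lt_trans; [|exact Hw]; eapply Rle_trans; [apply Rmax_r|exact Hm]).
specialize (H1 (Re w) (Im w)
  (Rlt_le_trans _ _ _ HA (Rmin_l _ _)) (Rlt_le_trans _ _ _ HB (Rmin_l _ _))).
specialize (H2 (Re w) (Im w)
  (Rlt_le_trans _ _ _ HA (Rmin_r _ _)) (Rlt_le_trans _ _ _ HB (Rmin_r _ _))).
simpl in H1, H2.
set (M := Rmax _ _) in *.
match goal with |- Cmod ?e <= _ => set (E := e) end.
assert (HEr : Rabs (Re E) <= eps / 2 * M).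
{ eapply Rle_trans; [|exact H1]; apply Req_le; f_equal.
  unfold E, Re, Im; destruct w, z; simpl; ring. }
assert (HEi : Rabs (Im E) <= eps / 2 * M).
{ eapply Rle_trans; [|exact H2]; apply Req_le; f_equal.
  unfold E, Re, Im; destruct w, z; simpl; ring. }
assert (Cmod E <= Rabs (Re E) + Rabs (Im E)).
{ replace E with (RtoC (Re E) + Ci * RtoC (Im E))%C at 1
    by (unfold Re, Im; destruct E; apply injective_projections; simpl; ring).
  eapply Rle_trans; [apply Cmod_triangle|].
  rewrite Cmod_mult, Cmod_Ci, !Cmod_R; lra. }
assert (eps * M <= eps * Cmod (w - z))
  by (apply Rmult_le_compat_l; [apply Rlt_le, cond_pos|exact Hm]).
lra.
Qed.

Lemma is_Cderive_Cexp (z : C) : is_Cderive Cexp z (Cexp z).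
Proof.
assert (He : differentiable_pt_lim (fun u _ => exp u) (Re z) (Im z) (exp (Re z)) 0)
  by apply differentiable_pt_lim_proj1_0, derivable_pt_lim_exp.
apply (is_Cderive_Cauchy_Riemann (fun x y => exp x * cos y) (fun x y => exp x * sin y)).
- eapply diff2_eq.
  + apply diff2_mult; [exact He|].
    apply (diff2_comp cos (fun _ v => v)); [apply derivable_pt_lim_cos|apply diff2_snd].
  + cbv beta; ring.
  + cbv beta; ring.
- eapply diff2_eq.
  + apply diff2_mult; [exact He|].
    apply (diff2_comp sin (fun _ v => v)); [apply derivable_pt_lim_sin|apply diff2_snd].
  + cbv beta; ring.
  + cbv beta; ring.
Qed.

(** With [s = |w|], the half-angle [q = y / (s + x)] satisfies
    [1 + q^2 = 2 s / (s + x)], which turns the partial derivatives of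
    [2 atan q] into [- y / s^2] and [x / s^2]. *)
Lemma is_Cderive_Clog (w : C) : 0 < Re w -> is_Cderive Clog w (/ w)%C.
Proof.
intros Hw.
set (x := Re w) in *; set (y := Im w).
set (S := fun u v : R => sqrt (u * u + v * v)).
assert (Hq : 0 < x * x + y * y) by nra.
assert (Hs : 0 < S x y) by (apply sqrt_lt_R0, Hq).
assert (Hss : S x y * S x y = x * x + y * y) by (apply sqrt_sqrt; lra).
set (s := S x y) in *.
assert (HS : differentiable_pt_lim S x y (x / s) (y / s)).
{ eapply diff2_eq.
  - apply (diff2_comp sqrt (fun u v => u * u + v * v)).
    + apply derivable_pt_lim_sqrt, Hq.
    + apply diff2_plus; apply diff2_mult;
        (apply diff2_fst || apply diff2_snd).
  - unfold s, S; field; exact (Rgt_not_eq _ _ Hs).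
  - unfold s, S; field; exact (Rgt_not_eq _ _ Hs). }
assert (Hz : (/ w)%C = (x / (s * s), - y / (s * s))).
{ rewrite Hss; unfold Cinv; fold (Re w) (Im w); fold x y.
  apply injective_projections; simpl; field; nra. }
rewrite Hz.
assert (Hext : forall u, (ln (S (Re u) (Im u)), 2 * atan (Im u * / (S (Re u) (Im u) + Re u))) = Clog u).
{ intros u; unfold Clog, Carg, Cmod, S, Rdiv; fold (Re u) (Im u).
  replace (Re u * Re u + Im u * Im u) with (Re u ^ 2 + Im u ^ 2) by ring; reflexivity. }
refine (is_Cderive_eq _ _ _ _ _ _ Hext eq_refl).
apply (is_Cderive_Cauchy_Riemann (fun u v => ln (S u v))
  (fun u v => 2 * atan (v * / (S u v + u)))); fold x y.
- eapply diff2_eq.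
  + apply (diff2_comp ln S); [apply derivable_pt_lim_ln, Hs|exact HS].
  + cbv beta; fold s; field; lra.
  + cbv beta; fold s; field; lra.
- eapply diff2_eq.
  + apply (diff2_comp (fun t => 2 * atan t) (fun u v => v * / (S u v + u))).
    * apply derivable_pt_lim_scal, derivable_pt_lim_atan.
    * apply diff2_mult; [apply diff2_snd|].
      apply (diff2_comp Rinv (fun u v => S u v + u)).
      -- apply is_derive_Reals, (is_derive_inv (fun t => t) _ 1);
           [apply (is_derive_id (K := R_AbsRing))|fold s; lra].
      -- apply diff2_plus; [exact HS|apply diff2_fst].
  + cbv beta; fold s.
    assert (Hyy : y * y = s * s - x * x) by lra.
    replace (1 + (y * / (s + x)) ^ 2) with (2 * s / (s + x)).
    * field; lra.
    * replace ((y * / (s + x)) ^ 2) with (y * y / ((s + x) * (s + x))) by (field; lra).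
      rewrite Hyy; field; lra.
  + cbv beta; fold s.
    assert (Hyy : y * y = s * s - x * x) by lra.
    replace (1 + (y * / (s + x)) ^ 2) with (2 * s / (s + x)).
    * replace (y * (- (1) / (s + x) ^ 2 * (y / s + 0)))
        with (- (y * y) / (s * (s + x) ^ 2)) by (field; lra).
      rewrite Hyy; field; lra.
    * replace ((y * / (s + x)) ^ 2) with (y * y / ((s + x) * (s + x))) by (field; lra).
      rewrite Hyy; field; lra.
Qed.

Lemma Cexp_plus (v w : C) : Cexp (v + w) = (Cexp v * Cexp w)%C.
Proof.
unfold Cexp; rewrite re_plus, im_plus, exp_plus, cos_plus, sin_plus.
apply injective_projections; simpl; ring.
Qed.

Lemma Cexp_RtoC (x : R) : Cexp (RtoC x) = RtoC (exp x).
Proof.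
unfold Cexp; rewrite re_RtoC, im_RtoC, cos_0, sin_0.
apply injective_projections; simpl; ring.
Qed.

Lemma Cexp_0 : Cexp (RtoC 0) = RtoC 1.
Proof. now rewrite Cexp_RtoC, exp_0. Qed.

Lemma Cmod_Cexp (v : C) : Cmod (Cexp v) = exp (Re v).
Proof.
unfold Cmod, Cexp; simpl fst; simpl snd.
replace ((exp (Re v) * cos (Im v)) ^ 2 + (exp (Re v) * sin (Im v)) ^ 2)
  with (exp (Re v) * exp (Re v) * ((sin (Im v))² + (cos (Im v))²))
  by (unfold Rsqr; ring).
rewrite sin2_cos2, Rmult_1_r.
apply sqrt_square, Rlt_le, exp_pos.
Qed.

Lemma Cexp_neq_0 (v : C) : Cexp v <> RtoC 0.
Proof. apply Cmod_gt_0; rewrite Cmod_Cexp; apply exp_pos. Qed.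

Lemma Cmod_gt_0_Re (w : C) : 0 < Re w -> 0 < Cmod w.
Proof.
intros Hw; apply Rlt_le_trans with (Re w); [exact Hw|].
eapply Rle_trans; [apply Rle_abs|apply re_le_Cmod].
Qed.

(** Here [q = tan (arg w / 2)], and [cos (arg w) = (1 - q^2) / (1 + q^2)],
    [sin (arg w) = 2 q / (1 + q^2)] with [1 + q^2 = 2 |w| / (|w| + Re w)]. *)
Lemma Cexp_Clog (w : C) : 0 < Re w -> Cexp (Clog w) = w.
Proof.
intros Hw.
assert (Hm := Cmod_gt_0_Re w Hw).
assert (Hsq := Cmod2_alt w).
unfold Cexp, Clog; simpl Re; simpl Im.
rewrite (exp_ln _ Hm).
unfold Carg; set (q := Im w / (Cmod w + Re w)).
set (s := Cmod w) in *; set (x := Re w) in *; set (y := Im w) in *.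
assert (Hq : 1 + q² = 2 * s / (s + x)).
{ unfold q, Rsqr, Rdiv.
  replace (y * / (s + x) * (y * / (s + x))) with ((y * y) / (s + x) ^ 2)
    by (field; lra).
  replace (y * y) with (s * s - x * x) by lra.
  field; lra. }
assert (Hq0 : 0 < 1 + q²) by (assert (H := Rle_0_sqr q); lra).
assert (Hr := sqrt_lt_R0 _ Hq0).
assert (Hrr := sqrt_sqrt _ (Rlt_le _ _ Hq0)).
rewrite cos_2a_cos, sin_2a, cos_atan, sin_atan.
set (r := sqrt (1 + q²)) in *.
assert (H1 : / (r * r) = (s + x) / (2 * s)) by (rewrite Hrr, Hq; field; lra).
apply injective_projections; simpl fst; simpl snd.
- replace (s * (2 * (1 / r) * (1 / r) - 1)) with (s * (2 * (/ (r * r)) - 1))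
    by (field; lra).
  rewrite H1; change (fst w) with x; field; lra.
- replace (s * (2 * (q / r) * (1 / r))) with (s * (2 * q * / (r * r)))
    by (field; lra).
  rewrite H1; change (snd w) with y; unfold q; field; lra.
Qed.

Lemma Clog_Cexp (v : C) : - (PI / 2) < Im v < PI / 2 -> Clog (Cexp v) = v.
Proof.
intros Hv.
unfold Clog; rewrite Cmod_Cexp, ln_exp.
apply injective_projections; [reflexivity|simpl snd].
unfold Carg; rewrite Cmod_Cexp; unfold Cexp; simpl Re; simpl Im.
change (snd v) with (Im v); set (y := Im v) in *; set (e := exp (Re v)).
assert (He : 0 < e) by apply exp_pos.
assert (Hc : 0 < cos (y / 2)) by (apply cos_gt_0; lra).
replace (e * sin y / (e + e * cos y)) with (tan (y / 2)).
- rewrite atan_tan by lra; field.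
- replace y with (2 * (y / 2)) at 2 3 by field.
  rewrite sin_2a, cos_2a_cos; unfold tan; field.
  split; [|lra].
  assert (0 < e * (cos (y / 2) * cos (y / 2)))
    by (apply Rmult_lt_0_compat; [|apply Rmult_lt_0_compat]; lra).
  lra.
Qed.

Lemma Clog_RtoC (x : R) : 0 < x -> Clog (RtoC x) = RtoC (ln x).
Proof.
intros Hx.
replace (RtoC x) with (Cexp (RtoC (ln x))) by (rewrite Cexp_RtoC, exp_ln; auto).
apply Clog_Cexp; rewrite im_RtoC; assert (H := PI_RGT_0); lra.
Qed.

Lemma Re_le_Cmod (w : C) : Re w <= Cmod w.
Proof. eapply Rle_trans; [apply Rle_abs|apply re_le_Cmod]. Qed.

Lemma Re_pos_near_1 (w : C) : Cmod (1 - w) < 1 -> 0 < Re w.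
Proof.
intros H; assert (H1 := Re_le_Cmod (1 - w)).
unfold Cminus in *; rewrite re_plus, re_opp, re_RtoC in H1; lra.
Qed.

Lemma Re_one_minus_pos (z : C) : in_disk z -> 0 < Re (1 - z).
Proof.
intros Hz; apply Re_pos_near_1.
replace (1 - (1 - z))%C with z by ring; exact Hz.
Qed.

(** * Growth along rays *)

(** The factor [e] lets a single real function carry the real part, the
    imaginary part, or the component in any prescribed direction. *)
Lemma is_derive_ray (f : C -> C) (e z l : C) (t : R) :
  is_Cderive f (RtoC t * z)%C l ->
  is_derive (fun s : R => Re (e * f (RtoC s * z)%C)) t (Re (e * (z * l))).
Proof.
intros Hf.
apply is_derive_Reals; intros eps Heps.
set (K := Cmod e * Cmod z + 1).
assert (HK : 0 < K).
{ assert (0 <= Cmod e * Cmod z) by (apply Rmult_le_pos; apply Cmod_ge_0).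
  unfold K; lra. }
assert (He' : 0 < eps / (2 * K)) by (apply Rdiv_lt_0_compat; lra).
destruct (proj1 (is_Cderive_eps_delta _ _ _) Hf (mkposreal _ He')) as [d Hd].
assert (Hz1 : 0 < Cmod z + 1) by (assert (H := Cmod_ge_0 z); lra).
assert (Hd' : 0 < d / (Cmod z + 1)) by (apply Rdiv_lt_0_compat; [apply cond_pos|exact Hz1]).
exists (mkposreal _ Hd'); intros h Hh Hhd; simpl in Hhd.
assert (Hsub : (RtoC (t + h) * z - RtoC t * z = RtoC h * z)%C)
  by (rewrite RtoC_plus; ring).
assert (Hin : Cmod (RtoC (t + h) * z - RtoC t * z) < d).
{ rewrite Hsub, Cmod_mult, Cmod_R.
  apply Rle_lt_trans with (Rabs h * (Cmod z + 1)).
  - apply Rmult_le_compat_l; [apply Rabs_pos|lra].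
  - apply Rmult_lt_reg_r with (/ (Cmod z + 1)); [now apply Rinv_0_lt_compat|].
    rewrite Rmult_assoc, Rinv_r, Rmult_1_r by lra; exact Hhd. }
specialize (Hd _ Hin); simpl in Hd; rewrite Hsub in Hd.
set (D := (f (RtoC (t + h) * z) - f (RtoC t * z) - RtoC h * z * l)%C) in Hd.
assert (Hid : Re (e * f (RtoC (t + h) * z)%C) - Re (e * f (RtoC t * z)%C)
  - Re (e * (z * l)) * h = Re (e * D)).
{ unfold D; destruct (f (RtoC (t + h) * z)%C), (f (RtoC t * z)%C), e, z, l.
  unfold Re; simpl; ring. }
replace ((Re (e * f (RtoC (t + h) * z)%C) - Re (e * f (RtoC t * z)%C)) / h
  - Re (e * (z * l))) with (Re (e * D) / h) by (rewrite <- Hid; field; exact Hh).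
unfold Rdiv; rewrite Rabs_mult, Rabs_inv.
assert (Hah : 0 < Rabs h) by now apply Rabs_pos_lt.
apply Rmult_lt_reg_r with (Rabs h); [exact Hah|].
rewrite Rmult_assoc, Rinv_l, Rmult_1_r by lra.
eapply Rle_lt_trans; [apply re_le_Cmod|].
rewrite Cmod_mult in *; rewrite Cmod_R in Hd.
assert (Cmod e * Cmod D <= Cmod e * (eps / (2 * K) * (Rabs h * Cmod z)))
  by (apply Rmult_le_compat_l; [apply Cmod_ge_0|exact Hd]).
assert (Heq : Cmod e * (eps / (2 * K) * (Rabs h * Cmod z))
  = eps * Rabs h * ((K - 1) / (2 * K))) by (unfold K; field; fold K; lra).
assert ((K - 1) / (2 * K) < 1).
{ apply Rmult_lt_reg_r with (2 * K); [lra|].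
  unfold Rdiv; rewrite Rmult_assoc, Rinv_l by lra; lra. }
assert (0 < eps * Rabs h) by (apply Rmult_lt_0_compat; lra).
nra.
Qed.

Lemma in_disk_ray (z : C) (t : R) :
  in_disk z -> 0 <= t <= 1 -> in_disk (RtoC t * z)%C.
Proof.
unfold in_disk; intros Hz Ht.
rewrite Cmod_mult, Cmod_R, Rabs_pos_eq by lra.
assert (H := Cmod_ge_0 z); nra.
Qed.

Lemma in_disk_RtoC (r : R) : 0 <= r < 1 -> in_disk (RtoC r).
Proof. intros Hr; unfold in_disk; rewrite Cmod_R, Rabs_pos_eq; lra. Qed.

Lemma unimodular_rotation (w : C) :
  exists e : C, Cmod e <= 1 /\ (e * w)%C = RtoC (Cmod w).
Proof.
destruct (Req_dec (Cmod w) 0) as [H0|H0].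
- exists (RtoC 0); rewrite H0, Cmod_0; split; [lra|ring].
- exists (Cconj w / RtoC (Cmod w))%C.
  assert (Hn : RtoC (Cmod w) <> 0) by (intros H; apply H0, RtoC_inj, H).
  split.
  + rewrite Cmod_div, Cmod_conj, Cmod_R, Rabs_pos_eq by
      (apply Cmod_ge_0 || exact Hn).
    apply Req_le; field; exact H0.
  + transitivity ((w * Cconj w) / RtoC (Cmod w))%C; [unfold Cdiv; ring|].
    rewrite <- Cmod2_conj, <- RtoC_div by exact H0.
    f_equal; field; exact H0.
Qed.

(** Rotate [f z - f 0] to the positive axis and compare the two real functions
    [t |-> Re (e f (t z))] and [t |-> Re (f (t |z|))]: the derivative of their
    difference is nonpositive. *)
Lemma Cmod_increment_le (f df : C -> C) :
  (forall z, in_disk z -> is_Cderive f z (df z)) ->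
  (forall z, in_disk z -> Cmod (df z) <= Re (df (RtoC (Cmod z)))) ->
  forall z, in_disk z ->
    Cmod (f z - f (RtoC 0)) <= Re (f (RtoC (Cmod z))) - Re (f (RtoC 0)).
Proof.
intros Hf Hdf z Hz.
set (r := Cmod z).
assert (Hr : 0 <= r < 1) by (split; [apply Cmod_ge_0|exact Hz]).
destruct (unimodular_rotation (f z - f (RtoC 0))) as [e [He1 He2]].
set (phi := fun t : R =>
  Re (e * f (RtoC t * z)%C) - Re (RtoC 1 * f (RtoC t * RtoC r)%C)).
set (dphi := fun t : R =>
  Re (e * (z * df (RtoC t * z)%C)) - Re (RtoC 1 * (RtoC r * df (RtoC t * RtoC r)%C))).
assert (Hphi : forall t, 0 <= t <= 1 -> is_derive phi t (dphi t)).
{ intros t Ht; apply (is_derive_minus (K := R_AbsRing) (V := R_NormedModule));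
    apply is_derive_ray, Hf, in_disk_ray; auto.
  now apply in_disk_RtoC. }
destruct (MVT_gen phi 0 1 dphi) as [c [Hc HM]].
- rewrite Rmin_left, Rmax_right by lra; intros t Ht; apply Hphi; lra.
- rewrite Rmin_left, Rmax_right by lra; intros t Ht.
  apply derivable_continuous_pt; exists (dphi t); apply is_derive_Reals, Hphi, Ht.
- rewrite Rmin_left, Rmax_right in Hc by lra.
  assert (Hneg : dphi c <= 0).
  { unfold dphi.
    assert (Hcz : RtoC (Cmod (RtoC c * z)) = (RtoC c * RtoC r)%C)
      by (rewrite Cmod_mult, Cmod_R, Rabs_pos_eq, RtoC_mult by lra; reflexivity).
    assert (Hb := Hdf _ (in_disk_ray z c Hz Hc)); rewrite Hcz in Hb.
    rewrite Cmult_1_l, re_scal_l.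
    assert (H1 := Re_le_Cmod (e * (z * df (RtoC c * z)%C))).
    rewrite !Cmod_mult in H1; fold r in H1.
    assert (0 <= Cmod e) by apply Cmod_ge_0.
    assert (Hm : 0 <= r * Cmod (df (RtoC c * z)%C))
      by (apply Rmult_le_pos; [lra|apply Cmod_ge_0]).
    assert (r * Cmod (df (RtoC c * z)%C) <= r * Re (df (RtoC c * RtoC r)%C))
      by (apply Rmult_le_compat_l; lra).
    nra. }
  unfold phi in HM; rewrite !Cmult_1_l, !Cmult_0_l in HM.
  assert (Hre : Re (e * f z) - Re (e * f (RtoC 0)) = Cmod (f z - f (RtoC 0))).
  { rewrite <- (re_RtoC (Cmod _)), <- He2; destruct e, (f z), (f (RtoC 0)).
    unfold Re; simpl; ring. }
  lra.
Qed.

(** By the intermediate value theorem [theta] cannot reach [PI / 2], where the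
    cosine vanishes. *)
Lemma lt_PI2_of_cos_pos (theta : R -> R) :
  (forall t, 0 <= t <= 1 -> continuity_pt theta t) ->
  (forall t, 0 <= t <= 1 -> 0 < cos (theta t)) ->
  theta 0 = 0 -> theta 1 < PI / 2.
Proof.
intros Hc Hpos H0.
assert (HPI := PI_RGT_0).
destruct (Rtotal_order (theta 1) (PI / 2)) as [H|[H|H]]; [exact H| |].
- assert (Hp := Hpos 1); rewrite H, cos_PI2 in Hp; lra.
- destruct (IVT_interv (fun t => theta t - PI / 2) 0 1) as [t [Ht1 Ht2]].
  + intros t Ht; apply continuity_pt_minus; [now apply Hc|].
    apply continuity_pt_const; intros ? ?; reflexivity.
  + lra.
  + rewrite H0; lra.
  + lra.
  + assert (Hp := Hpos t Ht1).
    replace (theta t) with (PI / 2) in Hp by lra; rewrite cos_PI2 in Hp; lra.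
Qed.

(** For a logarithm [L] of the factor to be absorbed, the Schwarz function is
    explicit: [omega = 1 - (1 - z) exp (L / mu)], and [slope] is its derivative.
    If [slope] is dominated by its values on the positive radius, then
    [|omega z| <= omega |z| = 1 - (1 - |z|) exp (L |z| / mu) <= |z|].

    It remains to see that the principal power of [1 - omega] is the expected
    one, that is, [Clog (1 - omega) = Clog (1 - z) + L / mu].  Both sides have
    the same exponential, so only the size of the imaginary part of the right
    side is at stake; along a ray it starts at [0], and its cosine stays
    positive because [Re (1 - omega) > 0]. *)
Lemma subordinate_of_log (mu : R) (L dL : C -> C) :
  mu <> 0 ->
  (forall z, in_disk z -> is_Cderive L z (dL z)) ->
  L (RtoC 0) = RtoC 0 ->
  (forall z, in_disk z ->
    let slope w :=
      (Cexp (RtoC (/ mu) * L w) * (1 - (1 - w) * (RtoC (/ mu) * dL w)))%C in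
    Cmod (slope z) <= Re (slope (RtoC (Cmod z)))) ->
  (forall r, 0 <= r < 1 -> 1 <= Re (Cexp (RtoC (/ mu) * L (RtoC r)))) ->
  subordinate
    (fun z : C => (Cpower (1 - z) mu * Cexp (L z))%C)
    (fun z : C => Cpower (1 - z) mu).
Proof.
intros Hmu HL HL0 Hslope Hreal.
set (E := fun z => Cexp (RtoC (/ mu) * L z)).
set (slope := fun w => (E w * (1 - (1 - w) * (RtoC (/ mu) * dL w)))%C).
set (omega := fun z => (1 - (1 - z) * E z)%C).
assert (HcL : forall z, in_disk z ->
  is_Cderive (fun w => RtoC (/ mu) * L w)%C z (RtoC (/ mu) * dL z)%C).
{ intros z Hz; eapply is_Cderive_eq;
    [apply is_Cderive_mult; [apply is_Cderive_const|apply HL, Hz]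
    |reflexivity|cbv beta; ring]. }
assert (Homega : forall z, in_disk z -> is_Cderive omega z (slope z)).
{ intros z Hz; eapply is_Cderive_eq;
    [apply is_Cderive_minus; [apply is_Cderive_const|];
     apply is_Cderive_mult; [apply is_Cderive_one_minus|];
     apply (is_Cderive_comp Cexp); [apply is_Cderive_Cexp|apply HcL, Hz]
    |reflexivity|unfold slope, E; ring]. }
assert (Homega0 : omega (RtoC 0) = RtoC 0).
{ unfold omega, E; rewrite HL0, Cmult_0_r, Cexp_0; ring. }
assert (Hgrowth : forall z, in_disk z -> Cmod (omega z) <= Cmod z).
{ intros z Hz.
  assert (H := Cmod_increment_le omega slope Homega Hslope z Hz).
  rewrite Homega0 in H.
  replace (omega z - RtoC 0)%C with (omega z) in H by ring.
  rewrite re_RtoC in H.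
  assert (Hr : 0 <= Cmod z < 1) by (split; [apply Cmod_ge_0|exact Hz]).
  assert (HE := Hreal _ Hr).
  assert (Hre : Re (omega (RtoC (Cmod z)))
    = 1 - (1 - Cmod z) * Re (E (RtoC (Cmod z)))).
  { unfold omega; rewrite <- RtoC_minus.
    unfold Cminus at 1; rewrite re_plus, re_opp, re_scal_l, re_RtoC; ring. }
  change (Cexp (RtoC (/ mu) * L (RtoC (Cmod z)))) with (E (RtoC (Cmod z))) in HE.
  nra. }
exists omega; split; [|split; [|split]].
- intros z Hz; exists (slope z); apply Homega, Hz.
- intros z Hz; unfold in_disk; eapply Rle_lt_trans; [apply Hgrowth, Hz|exact Hz].
- exact Hgrowth.
- intros z Hz.
  set (v := fun w => (Clog (1 - w) + RtoC (/ mu) * L w)%C).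
  assert (Hv : forall w, in_disk w -> Cexp (v w) = (1 - omega w)%C).
  { intros w Hw; unfold v, omega; rewrite Cexp_plus, (Cexp_Clog _ (Re_one_minus_pos w Hw)).
    fold (E w); ring. }
  assert (Hdv : forall w, in_disk w -> ex_derive (K := C_AbsRing) (V := C_NormedModule) v w).
  { intros w Hw; eexists; apply is_Cderive_plus; [|apply HcL, Hw].
    apply (is_Cderive_comp Clog); [apply is_Cderive_Clog, Re_one_minus_pos, Hw|apply is_Cderive_one_minus]. }
  assert (Hcos : forall w, in_disk w -> 0 < cos (Im (v w))).
  { intros w Hw.
    assert (Hre : 0 < Re (1 - omega w)).
    { apply Re_one_minus_pos; eapply Rle_lt_trans; [apply Hgrowth, Hw|exact Hw]. }
    rewrite <- (Hv w Hw) in Hre; change (0 < exp (Re (v w)) * cos (Im (v w))) in Hre.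
    assert (He := exp_pos (Re (v w))); nra. }
  assert (Hv0 : v (RtoC 0) = RtoC 0).
  { unfold v; rewrite HL0.
    replace (1 - RtoC 0)%C with (RtoC 1) by ring.
    rewrite (Clog_RtoC 1), ln_1 by lra; ring. }
  (* [e = 1] and [e = -1] give the two bounds on the argument; multiplying by
     [- e i] brings the imaginary part into the real-part form of a ray. *)
  assert (Him : forall e : R, (e = 1 \/ e = -1) -> e * Im (v z) < PI / 2).
  { intros e He.
    assert (Hth : forall t, Re (- RtoC e * Ci * v (RtoC t * z)%C) = e * Im (v (RtoC t * z)%C)).
    { intros t; destruct (v (RtoC t * z)%C); unfold Re, Im; simpl; ring. }
    assert (H := lt_PI2_of_cos_pos (fun t => Re (- RtoC e * Ci * v (RtoC t * z)%C))).
    cbv beta in H; rewrite !Hth, Cmult_1_l, Cmult_0_l, Hv0, im_RtoC, Rmult_0_r in H.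
    apply H; [| |reflexivity].
    - intros t Ht; destruct (Hdv _ (in_disk_ray z t Hz Ht)) as [l Hl].
      apply derivable_continuous_pt; eexists.
      apply is_derive_Reals, (is_derive_ray v (- RtoC e * Ci)), Hl.
    - intros t Ht; rewrite Hth.
      assert (Hp := Hcos _ (in_disk_ray z t Hz Ht)).
      destruct He as [-> | ->]; [now rewrite Rmult_1_l|].
      replace (-1 * Im (v (RtoC t * z)%C)) with (- Im (v (RtoC t * z)%C)) by ring.
      now rewrite cos_neg. }
  assert (Hlog : Clog (1 - omega z) = v z).
  { rewrite <- (Hv z Hz); apply Clog_Cexp.
    assert (H1 := Him 1 (or_introl eq_refl)).
    assert (H2 := Him (-1) (or_intror eq_refl)); lra. }
  unfold Cpower; rewrite Hlog, <- Cexp_plus; f_equal; unfold v.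
  rewrite Cmult_plus_distr_l, Cmult_assoc, <- RtoC_mult, Rinv_r, Cmult_1_l
    by exact Hmu; reflexivity.
Qed.

(** * Real polynomials evaluated in the disk *)

Definition Cpoly (d : nat -> R) (n : nat) (z : C) : C :=
  sum_n (fun k => (RtoC (d k) * z ^ k)%C) n.

Definition Rpoly (d : nat -> R) (n : nat) (x : R) : R :=
  sum_n (fun k => d k * x ^ k) n.

Definition Cpoly_deriv (d : nat -> R) (n : nat) (z : C) : C :=
  sum_n (fun k => (RtoC (INR k * d k) * z ^ pred k)%C) n.

Lemma Csum_Sn (u : nat -> C) (n : nat) :
  sum_n u (S n) = (sum_n u n + u (S n))%C.
Proof. exact (sum_Sn u n). Qed.

Lemma Rsum_Sn (u : nat -> R) (n : nat) :
  sum_n u (S n) = sum_n u n + u (S n).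
Proof. exact (sum_Sn u n). Qed.

Lemma Cpoly_0 (d : nat -> R) (z : C) : Cpoly d 0 z = RtoC (d 0%nat).
Proof. unfold Cpoly; rewrite sum_O; simpl; ring. Qed.

Lemma Cpoly_S (d : nat -> R) (n : nat) (z : C) :
  Cpoly d (S n) z = (Cpoly d n z + RtoC (d (S n)) * z ^ S n)%C.
Proof. apply Csum_Sn. Qed.

Lemma Rpoly_0 (d : nat -> R) (x : R) : Rpoly d 0 x = d 0%nat.
Proof. unfold Rpoly; rewrite sum_O; simpl; ring. Qed.

Lemma Rpoly_S (d : nat -> R) (n : nat) (x : R) :
  Rpoly d (S n) x = Rpoly d n x + d (S n) * x ^ S n.
Proof. apply Rsum_Sn. Qed.

Lemma Cpoly_RtoC (d : nat -> R) (n : nat) (x : R) :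
  Cpoly d n (RtoC x) = RtoC (Rpoly d n x).
Proof.
induction n as [|n IH]; [now rewrite Cpoly_0, Rpoly_0|].
rewrite Cpoly_S, Rpoly_S, IH, RtoC_plus, RtoC_mult, RtoC_pow; reflexivity.
Qed.

Lemma Rpoly_ge_0 (d : nat -> R) (n : nat) (x : R) :
  (forall k, (k <= n)%nat -> 0 <= d k) -> 0 <= x -> 0 <= Rpoly d n x.
Proof.
intros Hd Hx; induction n as [|n IH].
- rewrite Rpoly_0; apply Hd; lia.
- rewrite Rpoly_S; apply Rplus_le_le_0_compat; [apply IH; intros k Hk; apply Hd; lia|].
  apply Rmult_le_pos; [apply Hd; lia|now apply pow_le].
Qed.

Lemma Cpoly_scal (c : R) (d : nat -> R) (n : nat) (z : C) :
  Cpoly (fun k => c * d k) n z = (RtoC c * Cpoly d n z)%C.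
Proof.
induction n as [|n IH]; [now rewrite !Cpoly_0, RtoC_mult|].
rewrite !Cpoly_S, IH, RtoC_mult; ring.
Qed.

Lemma Cmod_Cpoly_le (d : nat -> R) (n : nat) (z : C) :
  (forall k, (k <= n)%nat -> 0 <= d k) ->
  Cmod (Cpoly d n z) <= Rpoly d n (Cmod z).
Proof.
intros Hd; induction n as [|n IH].
- rewrite Cpoly_0, Rpoly_0, Cmod_R, Rabs_pos_eq; [lra|apply Hd; lia].
- rewrite Cpoly_S, Rpoly_S.
  eapply Rle_trans; [apply Cmod_triangle|].
  apply Rplus_le_compat; [apply IH; intros k Hk; apply Hd; lia|].
  rewrite Cmod_mult, Cmod_R, Cmod_pow, Rabs_pos_eq; [lra|apply Hd; lia].
Qed.

Lemma Rpoly_ge_coef_0 (d : nat -> R) (n : nat) (x : R) :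
  (forall k, (1 <= k <= n)%nat -> 0 <= d k) -> 0 <= x -> d 0%nat <= Rpoly d n x.
Proof.
intros Hd Hx; induction n as [|n IH].
- rewrite Rpoly_0; lra.
- rewrite Rpoly_S.
  assert (d 0%nat <= Rpoly d n x) by (apply IH; intros k Hk; apply Hd; lia).
  assert (0 <= d (S n) * x ^ S n)
    by (apply Rmult_le_pos; [apply Hd; lia|now apply pow_le]).
  lra.
Qed.

Lemma Rpoly_le_scaled (d : nat -> R) (n : nat) (x : R) :
  d 0%nat = 0 -> (forall k, (k <= n)%nat -> 0 <= d k) -> 0 <= x <= 1 ->
  Rpoly d n x <= x * Rpoly d n 1.
Proof.
intros H0 Hd Hx; induction n as [|n IH].
- rewrite !Rpoly_0, H0; lra.
- rewrite !Rpoly_S, pow1.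
  assert (Rpoly d n x <= x * Rpoly d n 1) by (apply IH; intros k Hk; apply Hd; lia).
  assert (x ^ S n <= x).
  { simpl. assert (x ^ n <= 1) by (rewrite <- (pow1 n); apply pow_incr; lra).
    assert (0 <= x ^ n) by (apply pow_le; lra). nra. }
  assert (0 <= d (S n)) by (apply Hd; lia).
  nra.
Qed.

Lemma is_Cderive_pow (k : nat) (z : C) :
  is_Cderive (fun w => w ^ k)%C z (RtoC (INR k) * z ^ pred k)%C.
Proof.
induction k as [|k IH].
- eapply is_Cderive_eq; [apply (is_Cderive_const (RtoC 1))|reflexivity|simpl; ring].
- eapply is_Cderive_eq; [apply (is_Cderive_mult _ _ _ _ _ (is_Cderive_id z) IH)
    |reflexivity|].
  destruct k as [|k].
  + simpl; ring.
  + rewrite (S_INR (S k)), RtoC_plus; simpl pred; rewrite !Cpow_S; ring.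
Qed.

Lemma is_Cderive_Cpoly (d : nat -> R) (n : nat) (z : C) :
  is_Cderive (Cpoly d n) z (Cpoly_deriv d n z).
Proof.
apply (is_derive_sum_n (K := C_AbsRing) (V := C_NormedModule)
  (fun k w => (RtoC (d k) * w ^ k)%C)).
intros k _.
eapply is_Cderive_eq; [apply is_Cderive_mult;
  [apply is_Cderive_const|apply is_Cderive_pow]|reflexivity|].
cbv beta; rewrite RtoC_mult; ring.
Qed.

(** The coefficients of [mu s - (1 - z) s'] for a polynomial [s]; they vanish
    identically for the full series of [(1 - z)^(- mu)]. *)
Definition ode_coef (mu : R) (d : nat -> R) (k : nat) : R :=
  (mu + INR k) * d k - INR (S k) * d (S k).

(** The stray term is the contribution of [d (S n)], which [ode_coef] sees but
    the polynomial of degree [n] does not contain. *)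
Lemma ode_Cpoly (mu : R) (d : nat -> R) (n : nat) (z : C) :
  (RtoC mu * Cpoly d n z - (1 - z) * Cpoly_deriv d n z =
   Cpoly (ode_coef mu d) n z + RtoC (INR (S n) * d (S n)) * z ^ n)%C.
Proof.
unfold Cpoly_deriv, ode_coef; induction n as [|n IH].
- rewrite !Cpoly_0, sum_O; simpl; rewrite !RtoC_minus, !RtoC_mult, !RtoC_plus; ring.
- rewrite Csum_Sn, !Cpoly_S.
  set (A := sum_n _ n) in *; set (P := Cpoly d n z) in *; set (B := Cpoly _ n z) in *.
  transitivity ((RtoC mu * P - (1 - z) * A)
    + (RtoC mu * RtoC (d (S n)) * z ^ S n
       - (1 - z) * (RtoC (INR (S n) * d (S n)) * z ^ n)))%C; [cbv beta; simpl pred; rewrite RtoC_mult; ring|].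
  rewrite IH, (S_INR (S n)), !RtoC_minus, !RtoC_mult, !RtoC_plus, !Cpow_S; ring.
Qed.

Lemma Cpoly_summation_by_parts (d : nat -> R) (n : nat) (z : C) :
  ((1 - z) * Cpoly d n z =
   RtoC (d 0%nat) - z * Cpoly (fun k => d k - d (S k))%R n z
   - RtoC (d (S n)) * z ^ S n)%C.
Proof.
induction n as [|n IH].
- rewrite !Cpoly_0, RtoC_minus; simpl; ring.
- rewrite !Cpoly_S.
  set (P := Cpoly d n z) in *; set (B := Cpoly _ n z) in *.
  rewrite Cmult_plus_distr_l, IH, RtoC_minus, !Cpow_S; ring.
Qed.

(** * Subordination for polynomials with sign conditions *)

Lemma subordinate_ext (f f' g : C -> C) :
  (forall z, in_disk z -> f z = f' z) -> subordinate f g -> subordinate f' g.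
Proof.
intros Hf [w [H1 [H2 [H3 H4]]]]; exists w; repeat split; auto.
intros z Hz; rewrite <- Hf by exact Hz; now apply H4.
Qed.

(** With [s] the polynomial and [L] its logarithm, the derivative of
    [1 - (1 - z) s^(1/mu)] is [s^(1/mu - 1) * p], where
    [p = s - (1 - z) s' / mu].  The polynomial [p] has nonnegative coefficients,
    so [|p z| <= p |z|]; the last hypothesis is the same domination for the
    power of [s], written with logarithms so that it covers exponents of both
    signs. *)
Lemma subordinate_Cpoly_of_log (mu : R) (d : nat -> R) (n : nat) (L : C -> C) :
  mu <> 0 -> d 0%nat = 1 -> d (S n) = 0 ->
  (forall k, (k <= n)%nat -> 0 <= / mu * ode_coef mu d k) ->
  (forall z, in_disk z -> Cexp (L z) = Cpoly d n z) ->
  (forall z, in_disk z -> is_Cderive L z (Cpoly_deriv d n z / Cpoly d n z)%C) ->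
  (forall r, 0 <= r < 1 -> L (RtoC r) = RtoC (ln (Rpoly d n r))) ->
  (forall r, 0 <= r < 1 -> 0 <= / mu * ln (Rpoly d n r)) ->
  (forall z, in_disk z ->
    (/ mu - 1) * Re (L z) <= (/ mu - 1) * ln (Rpoly d n (Cmod z))) ->
  subordinate
    (fun z : C => (Cpower (1 - z) mu * Cpoly d n z)%C)
    (fun z : C => Cpower (1 - z) mu).
Proof.
intros Hmu H0 HS Hode HL HdL HLr Hsign Hmod.
apply (subordinate_ext (fun z => (Cpower (1 - z) mu * Cexp (L z))%C)).
{ intros z Hz; now rewrite HL. }
set (p := fun k => / mu * ode_coef mu d k).
assert (Hp : forall z, (Cpoly d n z - (1 - z) * (RtoC (/ mu) * Cpoly_deriv d n z)
  = Cpoly p n z)%C).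
{ intros z.
  assert (H := ode_Cpoly mu d n z).
  rewrite HS, Rmult_0_r, Cmult_0_l, Cplus_0_r in H.
  assert (Hscal : (Cpoly p n z = RtoC (/ mu) * Cpoly (ode_coef mu d) n z)%C)
    by apply Cpoly_scal.
  rewrite Hscal, <- H.
  assert (Hinv : (RtoC (/ mu) * RtoC mu = RtoC 1)%C)
    by (rewrite <- RtoC_mult, Rinv_l by exact Hmu; reflexivity).
  replace (RtoC (/ mu) * (RtoC mu * Cpoly d n z - (1 - z) * Cpoly_deriv d n z))%C
    with (RtoC (/ mu) * RtoC mu * Cpoly d n z
          - (1 - z) * (RtoC (/ mu) * Cpoly_deriv d n z))%C by ring.
  rewrite Hinv; ring. }
apply (subordinate_of_log mu L (fun z => Cpoly_deriv d n z / Cpoly d n z)%C).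
- exact Hmu.
- exact HdL.
- rewrite HLr by lra.
  replace (Rpoly d n 0) with 1; [now rewrite ln_1|].
  clear -H0; induction n as [|n IH]; [now rewrite Rpoly_0|].
  rewrite Rpoly_S, <- IH; simpl; ring.
- intros z Hz slope.
  assert (Hslope : forall w, in_disk w ->
    slope w = (Cexp (RtoC (/ mu - 1) * L w) * Cpoly p n w)%C).
  { intros w Hw; unfold slope; rewrite <- Hp.
    assert (Hne : Cpoly d n w <> RtoC 0) by (rewrite <- HL by exact Hw; apply Cexp_neq_0).
    replace (RtoC (/ mu) * L w)%C with (RtoC (/ mu - 1) * L w + L w)%C
      by (rewrite RtoC_minus; ring).
    rewrite Cexp_plus, (HL w Hw); field; exact Hne. }
  assert (Hr : 0 <= Cmod z < 1) by (split; [apply Cmod_ge_0|exact Hz]).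
  rewrite (Hslope z Hz), (Hslope _ (in_disk_RtoC _ Hr)).
  rewrite HLr, <- RtoC_mult, Cexp_RtoC, Cpoly_RtoC, <- RtoC_mult, re_RtoC by exact Hr.
  rewrite Cmod_mult, Cmod_Cexp, re_scal_l.
  apply Rmult_le_compat;
    [apply Rlt_le, exp_pos|apply Cmod_ge_0| |apply Cmod_Cpoly_le; exact Hode].
  destruct (Hmod z Hz) as [Hlt|Heq]; [apply Rlt_le, exp_increasing, Hlt|].
  rewrite Heq; apply Rle_refl.
- intros r Hr; rewrite HLr, <- RtoC_mult, Cexp_RtoC, re_RtoC by exact Hr.
  rewrite <- exp_0.
  destruct (Hsign r Hr) as [Hlt|Heq]; [apply Rlt_le, exp_increasing, Hlt|].
  rewrite <- Heq; apply Rle_refl.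
Qed.

Lemma ln_le_compat (x y : R) : 0 < x -> x <= y -> ln x <= ln y.
Proof.
intros Hx [H| ->]; [apply Rlt_le, ln_increasing; assumption|apply Rle_refl].
Qed.

Lemma Re_log_Cmod (v w : C) : Cexp v = w -> Re v = ln (Cmod w).
Proof. intros <-; now rewrite Cmod_Cexp, ln_exp. Qed.

(** Since [mu <= 1], the condition on [ode_coef] makes the coefficients
    nonincreasing, and summation by parts then gives
    [|1 - (1 - z) s| <= 1 - (1 - |z|) s |z| < 1], as in the Enestrom-Kakeya
    theorem.  Hence [Clog ((1 - z) s) - Clog (1 - z)] is a logarithm of [s],
    although [s] itself may leave the right half-plane.  The exponent
    [1/mu - 1] is nonnegative and [|s z| <= s |z|]. *)
Lemma subordinate_Cpoly_pos (mu : R) (d : nat -> R) (n : nat) :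
  0 < mu <= 1 -> d 0%nat = 1 -> d (S n) = 0 ->
  (forall k, (k <= n)%nat -> 0 <= d k) ->
  (forall k, (k <= n)%nat -> 0 <= ode_coef mu d k) ->
  subordinate
    (fun z : C => (Cpower (1 - z) mu * Cpoly d n z)%C)
    (fun z : C => Cpower (1 - z) mu).
Proof.
intros Hmu H0 HS Hd Hode.
assert (Hge1 : forall r, 0 <= r < 1 -> 1 <= Rpoly d n r).
{ intros r Hr; rewrite <- H0; apply Rpoly_ge_coef_0; [|lra].
  intros k Hk; apply Hd; lia. }
assert (Hdecr : forall k, (k <= n)%nat -> 0 <= d k - d (S k)).
{ intros k Hk; assert (H := Hode k Hk); unfold ode_coef in H.
  assert (Hk0 := Hd k Hk); assert (HI := pos_INR k); rewrite S_INR in H.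
  nra. }
set (Q := fun z => ((1 - z) * Cpoly d n z)%C).
assert (HQ : forall z, in_disk z -> 0 < Re (Q z)).
{ intros z Hz; apply Re_pos_near_1.
  set (e := fun k => d k - d (S k)).
  assert (Hparts : forall w, (1 - Q w = w * Cpoly e n w)%C).
  { intros w; unfold Q; rewrite Cpoly_summation_by_parts, H0, HS; fold e; ring. }
  rewrite Hparts, Cmod_mult.
  assert (Hr : 0 <= Cmod z < 1) by (split; [apply Cmod_ge_0|exact Hz]).
  assert (Hle := Cmod_Cpoly_le e n z Hdecr).
  assert (Hreal := Hparts (RtoC (Cmod z))); unfold Q in Hreal.
  rewrite !Cpoly_RtoC, <- RtoC_minus, <- !RtoC_mult, <- RtoC_minus in Hreal.
  apply RtoC_inj in Hreal.
  assert (H1 := Hge1 _ Hr).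
  assert (Cmod z * Cmod (Cpoly e n z) <= Cmod z * Rpoly e n (Cmod z))
    by (apply Rmult_le_compat_l; lra).
  nra. }
assert (Hne : forall w, 0 < Re w -> w <> RtoC 0).
{ intros w Hw ->; rewrite re_RtoC in Hw; lra. }
assert (HL : forall z, in_disk z -> Cexp (Clog (Q z) - Clog (1 - z)) = Cpoly d n z).
{ intros z Hz.
  assert (H1 := Hne _ (Re_one_minus_pos z Hz)).
  assert (H : (Cexp (Clog (Q z) - Clog (1 - z)) * Cexp (Clog (1 - z)) = Q z)%C).
  { rewrite <- Cexp_plus.
    replace (Clog (Q z) - Clog (1 - z) + Clog (1 - z))%C with (Clog (Q z)) by ring.
    now apply Cexp_Clog, HQ. }
  rewrite (Cexp_Clog (1 - z)) in H by now apply Re_one_minus_pos.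
  set (E := Cexp _) in *.
  transitivity ((E * (1 - z)) / (1 - z))%C; [|rewrite H; unfold Q]; field; exact H1. }
apply (subordinate_Cpoly_of_log mu d n (fun z => Clog (Q z) - Clog (1 - z))%C);
  try assumption.
- lra.
- intros k Hk; apply Rmult_le_pos; [apply Rlt_le, Rinv_0_lt_compat; lra|auto].
- intros z Hz.
  assert (H1 := Hne _ (Re_one_minus_pos z Hz)).
  assert (H2 : Cpoly d n z <> RtoC 0) by (rewrite <- HL by exact Hz; apply Cexp_neq_0).
  eapply is_Cderive_eq; [apply is_Cderive_minus;
    [apply (is_Cderive_comp Clog); [apply is_Cderive_Clog, HQ, Hz|];
     apply is_Cderive_mult; [apply is_Cderive_one_minus|apply is_Cderive_Cpoly]
    |apply (is_Cderive_comp Clog); [apply is_Cderive_Clog, Re_one_minus_pos, Hz|apply is_Cderive_one_minus]]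
    |reflexivity|].
  unfold Q; field; split; assumption.
- intros r Hr; unfold Q; assert (H := Hge1 r Hr).
  rewrite Cpoly_RtoC, <- RtoC_minus, <- RtoC_mult, !Clog_RtoC, ln_mult by nra.
  rewrite <- RtoC_minus; f_equal; ring.
- intros r Hr; apply Rmult_le_pos; [apply Rlt_le, Rinv_0_lt_compat; lra|].
  rewrite <- ln_1; apply ln_le_compat; [lra|auto].
- intros z Hz; apply Rmult_le_compat_l.
  + assert (1 <= / mu) by (rewrite <- Rinv_1; apply Rinv_le_contravar; lra); lra.
  + rewrite (Re_log_Cmod _ _ (HL z Hz)).
    apply ln_le_compat; [|now apply Cmod_Cpoly_le].
    rewrite <- (HL z Hz), Cmod_Cexp; apply exp_pos.
Qed.

(** Here [1 - s] has nonnegative coefficients, so [|1 - s z| <= 1 - s |z|].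
    Evaluating [mu s - (1 - z) s'] at [z = 1] gives [s 1 >= 0], whence
    [s r >= 1 - r > 0] on the radius; thus [s] stays in the right half-plane and
    [Clog s] is a logarithm.  The exponent [1/mu - 1] is negative and
    [|s z| >= s |z|]. *)
Lemma subordinate_Cpoly_neg (mu : R) (d : nat -> R) (n : nat) :
  mu < 0 -> d 0%nat = 1 -> d (S n) = 0 ->
  (forall k, (1 <= k <= n)%nat -> d k <= 0) ->
  (forall k, (k <= n)%nat -> ode_coef mu d k <= 0) ->
  subordinate
    (fun z : C => (Cpower (1 - z) mu * Cpoly d n z)%C)
    (fun z : C => Cpower (1 - z) mu).
Proof.
intros Hmu H0 HS Hd Hode.
set (e := fun k => match k with O => 0 | S _ => - d k end).
assert (He : forall k, (k <= n)%nat -> 0 <= e k).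
{ intros [|k] Hk; simpl; [lra|].
  assert (H := Hd (S k) ltac:(lia)); lra. }
assert (HC : forall z, (1 - Cpoly d n z = Cpoly e n z)%C).
{ intros z; clear -H0; induction n as [|n IH].
  - rewrite !Cpoly_0, H0; simpl; ring.
  - rewrite !Cpoly_S, <- IH; simpl e; rewrite RtoC_opp; ring. }
assert (HR : forall x, Rpoly e n x = 1 - Rpoly d n x).
{ intros x; apply RtoC_inj; rewrite RtoC_minus, <- !Cpoly_RtoC; now rewrite HC. }
assert (Hsum : 0 <= Rpoly d n 1).
{ assert (H := ode_Cpoly mu d n (RtoC 1)).
  rewrite HS, Rmult_0_r in H.
  assert (H' : RtoC (mu * Rpoly d n 1) = RtoC (Rpoly (ode_coef mu d) n 1)).
  { rewrite RtoC_mult, <- !Cpoly_RtoC.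
    transitivity (Cpoly (ode_coef mu d) n (RtoC 1) + RtoC 0 * RtoC 1 ^ n)%C;
      [rewrite <- H|]; ring. }
  apply RtoC_inj in H'.
  assert (Rpoly (ode_coef mu d) n 1 <= 0).
  { clear -Hode; induction n as [|n IH].
    - rewrite Rpoly_0; apply Hode; lia.
    - rewrite Rpoly_S, pow1.
      assert (Rpoly (ode_coef mu d) n 1 <= 0) by (apply IH; intros k Hk; apply Hode; lia).
      assert (ode_coef mu d (S n) <= 0) by (apply Hode; lia).
      lra. }
  nra. }
assert (Hpos : forall r, 0 <= r < 1 -> 0 < Rpoly d n r).
{ intros r Hr.
  assert (H := Rpoly_le_scaled e n r eq_refl He ltac:(lra)).
  rewrite !HR in H; nra. }
assert (Hle1 : forall r, 0 <= r < 1 -> Rpoly d n r <= 1).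
{ intros r Hr; assert (H := Rpoly_ge_0 e n r He ltac:(lra)); rewrite HR in H; lra. }
assert (Hdist : forall z, Cmod (1 - Cpoly d n z) <= 1 - Rpoly d n (Cmod z)).
{ intros z; rewrite HC, <- HR; now apply Cmod_Cpoly_le. }
assert (HRe : forall z, in_disk z -> 0 < Re (Cpoly d n z)).
{ intros z Hz; apply Re_pos_near_1.
  assert (Hr : 0 <= Cmod z < 1) by (split; [apply Cmod_ge_0|exact Hz]).
  assert (H := Hdist z); assert (H' := Hpos _ Hr); lra. }
assert (Hinv : / mu < 0) by now apply Rinv_lt_0_compat.
apply (subordinate_Cpoly_of_log mu d n (fun z => Clog (Cpoly d n z)));
  try assumption.
- lra.
- intros k Hk; assert (H := Hode k Hk); nra.
- intros z Hz; apply Cexp_Clog, HRe, Hz.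
- intros z Hz; apply (is_Cderive_comp Clog);
    [apply is_Cderive_Clog, HRe, Hz|apply is_Cderive_Cpoly].
- intros r Hr; rewrite Cpoly_RtoC; apply Clog_RtoC, Hpos, Hr.
- intros r Hr.
  assert (ln (Rpoly d n r) <= 0)
    by (rewrite <- ln_1; apply ln_le_compat; auto).
  nra.
- intros z Hz.
  assert (Hr : 0 <= Cmod z < 1) by (split; [apply Cmod_ge_0|exact Hz]).
  change (Re (Clog (Cpoly d n z))) with (ln (Cmod (Cpoly d n z))).
  assert (ln (Rpoly d n (Cmod z)) <= ln (Cmod (Cpoly d n z))).
  { apply ln_le_compat; [now apply Hpos|].
    assert (H := Hdist z); assert (H' := Cmod_triangle (1 - Cpoly d n z) (Cpoly d n z)).
    replace (1 - Cpoly d n z + Cpoly d n z)%C with (RtoC 1) in H' by ring.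
    rewrite Cmod_1 in H'; lra. }
  nra.
Qed.

(** * Taylor coefficients of the power of 1 - z *)

(** [p] stands for the real or the imaginary part. *)
Lemma is_pseries_real_part (p : C -> R) (a : nat -> C) (x : R) (l : C) :
  (forall v w : C, p (v + w)%C = p v + p w) ->
  (forall (r : R) (w : C), p (RtoC r * w)%C = r * p w) ->
  (forall w : C, Rabs (p w) <= Cmod w) ->
  is_pseries (K := C_AbsRing) (V := C_NormedModule) a (RtoC x) l ->
  is_pseries (K := R_AbsRing) (V := R_NormedModule) (fun k => p (a k)) x (p l).
Proof.
intros Hadd Hscal Hle H.
assert (Hpow : forall k, pow_n (K := C_Ring) (RtoC x) k = RtoC (pow_n (K := R_Ring) x k)).
{ induction k as [|k IH]; [reflexivity|].
  simpl pow_n; rewrite IH; symmetry; apply RtoC_mult. }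
assert (Hsum : forall n,
  sum_n (fun k => scal (pow_n (K := R_Ring) x k) (p (a k))) n =
  p (sum_n (fun k => scal (V := C_NormedModule) (pow_n (K := C_Ring) (RtoC x) k) (a k)) n)).
{ induction n as [|n IH].
  - rewrite !sum_O, Hpow; symmetry; apply Hscal.
  - rewrite !sum_Sn, IH, Hpow; symmetry.
    exact (eq_trans (Hadd _ _) (f_equal (Rplus _) (Hscal _ _))). }
apply filterlim_locally; intros eps.
destruct (proj1 (filterlim_locally_ball_norm _ _) H eps) as [N HN].
exists N; intros n Hn; specialize (HN n Hn).
apply norm_compat1; rewrite Hsum.
eapply Rle_lt_trans; [|exact HN].
set (S := sum_n _ n).
change (Rabs (p S + - p l) <= Cmod (S - l)).
replace (p S + - p l) with (p (S - l)%C); [apply Hle|].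
replace (S - l)%C with (S + RtoC (-1) * l)%C by ring.
rewrite Hadd, Hscal; ring.
Qed.

Lemma CV_radius_ge_1 (a : nat -> R) :
  (forall x, Rabs x < 1 -> ex_pseries a x) -> Rbar_le 1 (CV_radius a).
Proof.
intros H; destruct (Rbar_lt_le_dec (CV_radius a) 1) as [Hlt|Hle]; [|exact Hle].
exfalso; assert (H0 := CV_radius_ge_0 a).
destruct (CV_radius a) as [r| |] eqn:Hr; simpl in *; try easy.
assert (Habs : Rabs ((r + 1) / 2) = (r + 1) / 2) by (apply Rabs_pos_eq; lra).
apply (CV_disk_outside a ((r + 1) / 2)).
- rewrite Hr, Habs; simpl; lra.
- apply ex_series_lim_0.
  destruct (H ((r + 1) / 2)) as [l Hl]; [rewrite Habs; lra|].
  exists l; revert Hl; apply is_series_ext; intros k.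
  rewrite pow_n_pow; apply Rmult_comm.
Qed.

Lemma coef_eq_0 (a : nat -> R) :
  (forall x, Rabs x < 1 -> is_pseries a x 0) -> forall n, a n = 0.
Proof.
intros H n.
apply (PSeries_ext_recip a (fun _ => 0) n).
- eapply Rbar_lt_le_trans; [|apply CV_radius_ge_1; intros x Hx; exists 0; exact (H x Hx)].
  simpl; lra.
- rewrite CV_radius_const_0; exact I.
- exists (mkposreal 1 Rlt_0_1); intros x Hx.
  rewrite PSeries_const_0; apply is_pseries_unique, H.
  change (Rabs (x - 0) < 1) in Hx; now rewrite Rminus_0_r in Hx.
Qed.

Lemma f_mu_RtoC (mu x : R) :
  x < 1 -> f_mu mu (RtoC x) = RtoC (exp (- mu * ln (1 - x))).
Proof.
intros Hx; unfold f_mu, Cpower.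
rewrite <- RtoC_minus, Clog_RtoC, <- RtoC_mult, Cexp_RtoC by lra.
rewrite <- RtoC_div by (apply Rgt_not_eq, exp_pos).
f_equal; unfold Rdiv; rewrite Rmult_1_l, <- exp_Ropp; f_equal; ring.
Qed.

(** The sum [f] of the series satisfies [(1 - x) f' = mu f] on [(-1, 1)]; the
    recurrence is the comparison of coefficients in this equation. *)
Lemma f_mu_coef_rec (mu : R) (a : nat -> R) :
  (forall x, Rabs x < 1 -> is_pseries a x (exp (- mu * ln (1 - x)))) ->
  a 0%nat = 1 /\ forall k, INR (S k) * a (S k) = (mu + INR k) * a k.
Proof.
intros H.
set (f := fun x => exp (- mu * ln (1 - x))).
assert (Hrad : forall x, Rabs x < 1 -> Rbar_lt (Rabs x) (CV_radius a)).
{ intros x Hx; eapply Rbar_lt_le_trans;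
    [|apply CV_radius_ge_1; intros y Hy; eexists; apply H, Hy].
  exact Hx. }
assert (Hps : forall x, Rabs x < 1 -> PSeries a x = f x)
  by (intros x Hx; apply is_pseries_unique, H, Hx).
split.
- rewrite <- PSeries_0, Hps by (rewrite Rabs_R0; lra).
  unfold f; rewrite Rminus_0_r, ln_1, Rmult_0_r; apply exp_0.
- assert (Hder : forall x, Rabs x < 1 -> Derive (PSeries a) x = mu * f x / (1 - x)).
  { intros x Hx; apply is_derive_unique.
    apply (is_derive_ext_loc f).
    - assert (Hd : 0 < 1 - Rabs x) by lra.
      exists (mkposreal _ Hd); intros y Hy; symmetry; apply Hps.
      change (Rabs (y - x) < 1 - Rabs x) in Hy.
      replace y with ((y - x) + x) by ring.
      eapply Rle_lt_trans; [apply Rabs_triang|lra].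
    - apply Rabs_def2 in Hx; unfold f; auto_derive; [lra|change (1 + - x) with (1 - x); field; lra]. }
  set (b := PS_derive a).
  assert (Hzero := coef_eq_0 (PS_minus (PS_minus b (PS_incr_1 b)) (PS_scal mu a))).
  assert (Hc : forall n, PS_minus (PS_minus b (PS_incr_1 b)) (PS_scal mu a) n = 0).
  { apply Hzero; intros x Hx.
    assert (Hb := is_pseries_derive a x (Hrad x Hx)); fold b in Hb.
    rewrite Hder in Hb by exact Hx.
    assert (Hall := is_pseries_minus _ _ _ _ _
      (is_pseries_minus _ _ _ _ _ Hb (is_pseries_incr_1 _ _ _ Hb))
      (is_pseries_scal mu a x (f x) (Rmult_comm _ _) (H x Hx))).
    match type of Hall with is_pseries _ _ ?l => replace l with 0 in Hall end.
    - exact Hall.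
    - apply Rabs_def2 in Hx.
      change (0 = mu * f x / (1 - x) + - (x * (mu * f x / (1 - x))) + - (mu * f x)).
      field; lra. }
  intros [|k].
  + assert (H0 := Hc 0%nat).
    change (INR 1 * a 1%nat + - 0 + - (mu * a 0%nat) = 0) in H0.
    change (INR 0) with 0; lra.
  + assert (H0 := Hc (S k)).
    change (INR (S (S k)) * a (S (S k)) + - (INR (S k) * a (S k))
      + - (mu * a (S k)) = 0) in H0.
    lra.
Qed.

(** A complex power series is determined by its values on the real segment,
    where its real and imaginary parts are real power series. *)
Lemma power_series_f_mu_coef (mu : R) (a : nat -> C) :
  power_series_on_disk a (f_mu mu) ->
  exists alpha : nat -> R,
    (forall k, a k = RtoC (alpha k)) /\ alpha 0%nat = 1 /\
    forall k, INR (S k) * alpha (S k) = (mu + INR k) * alpha k.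
Proof.
intros H.
assert (Hx : forall x, Rabs x < 1 ->
  is_pseries (K := C_AbsRing) (V := C_NormedModule) a (RtoC x)
    (RtoC (exp (- mu * ln (1 - x))))).
{ intros x Hx; rewrite <- f_mu_RtoC by (apply Rabs_def2 in Hx; lra).
  apply H; unfold in_disk; now rewrite Cmod_R. }
assert (Him : forall k, Im (a k) = 0).
{ apply coef_eq_0; intros x Hx'.
  rewrite <- (im_RtoC (exp (- mu * ln (1 - x)))).
  apply is_pseries_real_part; auto using im_plus, im_scal_l.
  intros w; eapply Rle_trans; [apply Rmax_r|apply Rmax_Cmod]. }
exists (fun k => Re (a k)); split.
- intros k; apply injective_projections; [reflexivity|apply Him].
- apply (f_mu_coef_rec mu (fun k => Re (a k))); intros x Hx'.
  rewrite <- (re_RtoC (exp (- mu * ln (1 - x)))).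
  apply is_pseries_real_part; auto using re_plus, re_scal_l, re_le_Cmod.
Qed.

(** * Monotonicity of the Cesaro weights *)

Lemma pochhammer_pos (x : R) (k : nat) : 0 < x -> 0 < pochhammer x k.
Proof.
intros Hx; induction k as [|k IH]; simpl; [lra|].
apply Rmult_lt_0_compat; [exact IH|]; assert (H := pos_INR k); lra.
Qed.

Lemma cesaro_B_pos (b c : R) (k : nat) :
  0 < c -> c <= b -> 0 < cesaro_B b c k.
Proof.
intros Hc Hb; destruct k as [|k]; unfold cesaro_B; [lra|].
apply Rmult_lt_0_compat; apply Rdiv_lt_0_compat; try apply pochhammer_pos; lra.
Qed.

(** The first step uses [b >= 2 c - 1], since [B_1 = (1 + b - c) / c]; the later
    ones use [b >= c], since [B_(k+1) / B_k = (b + k) / (c + k)]. *)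
Lemma cesaro_B_incr (b c : R) (k : nat) :
  0 < c -> c <= b -> 2 * c - 1 <= b -> cesaro_B b c k <= cesaro_B b c (S k).
Proof.
intros Hc Hb Hb2; destruct k as [|k].
- unfold cesaro_B; simpl.
  replace (1 * (b + 0) / (1 * (c + 0)) * ((1 + b - c) / b))
    with (1 + (1 + b - 2 * c) / c) by (field; lra).
  assert (0 <= (1 + b - 2 * c) / c)
    by (apply Rmult_le_pos; [lra|apply Rlt_le, Rinv_0_lt_compat, Hc]).
  lra.
- assert (H := cesaro_B_pos b c (S k) Hc Hb).
  assert (HI := pos_INR (S k)).
  assert (Hp := pochhammer_pos c (S k) Hc).
  assert (Hrec : cesaro_B b c (S (S k))
    = cesaro_B b c (S k) * (1 + (b - c) / (c + INR (S k)))).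
  { unfold cesaro_B.
    change (pochhammer b (S (S k))) with (pochhammer b (S k) * (b + INR (S k))).
    change (pochhammer c (S (S k))) with (pochhammer c (S k) * (c + INR (S k))).
    field; lra. }
  rewrite Hrec.
  assert (0 <= (b - c) / (c + INR (S k)))
    by (apply Rmult_le_pos; [lra|apply Rlt_le, Rinv_0_lt_compat; lra]).
  nra.
Qed.

(** Extended by [0] past [n], so that the weights remain nonincreasing there. *)
Definition cesaro_weight (b c : R) (n k : nat) : R :=
  if Nat.leb k n then cesaro_B b c (n - k) / cesaro_B b c n else 0.

Lemma cesaro_weight_le (b c : R) (n k : nat) :
  (k <= n)%nat ->
  cesaro_weight b c n k = cesaro_B b c (n - k) / cesaro_B b c n.
Proof. intros Hk; unfold cesaro_weight; now rewrite (proj2 (Nat.leb_le k n) Hk). Qed.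

Lemma cesaro_weight_gt (b c : R) (n k : nat) :
  (n < k)%nat -> cesaro_weight b c n k = 0.
Proof. intros Hk; unfold cesaro_weight; now rewrite (proj2 (Nat.leb_gt k n) Hk). Qed.

Lemma cesaro_weight_ge_0 (b c : R) (n k : nat) :
  0 < c -> c <= b -> 0 <= cesaro_weight b c n k.
Proof.
intros Hc Hb; destruct (Nat.le_gt_cases k n) as [Hk|Hk].
- rewrite cesaro_weight_le by exact Hk.
  apply Rlt_le, Rdiv_lt_0_compat; now apply cesaro_B_pos.
- rewrite cesaro_weight_gt by exact Hk; lra.
Qed.

Lemma cesaro_weight_decr (b c : R) (n k : nat) :
  0 < c -> c <= b -> 2 * c - 1 <= b ->
  cesaro_weight b c n (S k) <= cesaro_weight b c n k.
Proof.
intros Hc Hb Hb2; destruct (Nat.le_gt_cases (S k) n) as [Hk|Hk].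
- rewrite !cesaro_weight_le by lia.
  apply Rmult_le_compat_r; [apply Rlt_le, Rinv_0_lt_compat; now apply cesaro_B_pos|].
  replace (n - k)%nat with (S (n - S k)) by lia.
  now apply cesaro_B_incr.
- rewrite cesaro_weight_gt by exact Hk; now apply cesaro_weight_ge_0.
Qed.

Lemma cesaro_mean_Cpoly (b c : R) (n : nat) (alpha : nat -> R) (a : nat -> C) (z : C) :
  0 < c -> c <= b -> (forall k, a k = RtoC (alpha k)) ->
  cesaro_mean b c n a z = Cpoly (fun k => cesaro_weight b c n k * alpha k) n z.
Proof.
intros Hc Hb Ha; unfold cesaro_mean, Cpoly.
assert (HB := cesaro_B_pos b c n Hc Hb).
transitivity (sum_n (fun k => / RtoC (cesaro_B b c n) *
  (RtoC (cesaro_B b c (n - k)) * a k * z ^ k))%C n).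
- symmetry; exact (sum_n_mult_l (K := C_Ring) _ _ n).
- apply sum_n_ext_loc; intros k Hk.
  rewrite cesaro_weight_le, Ha, RtoC_mult, RtoC_div by (exact Hk || lra).
  refine (_ : @eq C _ _); unfold Cdiv; ring.
Qed.

(** * The theorem *)

Theorem theorem2p1 :
  forall (b c mu : R) (n : nat),
    Rmax c (2 * c - 1) <= b ->
    0 < Rmax c (2 * c - 1) ->
    -1 <= mu <= 1 ->
    forall a : nat -> C,
      power_series_on_disk a (f_mu mu) ->
      subordinate
        (fun z : C => (Cpower (1 - z) mu * cesaro_mean b c n a z)%C)
        (fun z : C => Cpower (1 - z) mu).
Proof.
intros b c mu n Hb Hpos Hmu a Ha.
assert (Hb1 : c <= b) by (eapply Rle_trans; [apply Rmax_l|exact Hb]).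
assert (Hb2 : 2 * c - 1 <= b) by (eapply Rle_trans; [apply Rmax_r|exact Hb]).
assert (Hc : 0 < c) by (revert Hpos; apply Rmax_case; lra).
clear Hb Hpos.
destruct (power_series_f_mu_coef mu a Ha) as [alpha [Haa [H0 Hrec]]].
set (lam := cesaro_weight b c n).
set (d := fun k => lam k * alpha k).
apply (subordinate_ext (fun z => (Cpower (1 - z) mu * Cpoly d n z)%C)).
{ intros z _; unfold d, lam; now rewrite <- (cesaro_mean_Cpoly b c n alpha a). }
assert (Hlam : forall k, 0 <= lam k) by (intros k; now apply cesaro_weight_ge_0).
assert (Hdecr : forall k, 0 <= lam k - lam (S k))
  by (intros k; assert (H := cesaro_weight_decr b c n k Hc Hb1 Hb2); fold lam in H; lra).
assert (Hd0 : d 0%nat = 1).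
{ unfold d, lam; rewrite H0, cesaro_weight_le, Nat.sub_0_r by lia.
  assert (H := cesaro_B_pos b c n Hc Hb1); field; lra. }
assert (HdS : d (S n) = 0) by (unfold d, lam; rewrite cesaro_weight_gt by lia; ring).
(* The recurrence for [alpha] cancels all but the decrease of the weights. *)
assert (Hode : forall k,
  ode_coef mu d k = (mu + INR k) * alpha k * (lam k - lam (S k))).
{ intros k; unfold ode_coef, d.
  replace (INR (S k) * (lam (S k) * alpha (S k)))
    with (lam (S k) * (INR (S k) * alpha (S k))) by ring.
  rewrite Hrec; ring. }
assert (Hnext : forall k, alpha (S k) = (mu + INR k) * alpha k / INR (S k)).
{ intros k; rewrite <- Hrec; field; apply not_0_INR; lia. }
assert (HinvS : forall k, 0 < / INR (S k))
  by (intros k; apply Rinv_0_lt_compat, lt_0_INR; lia).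
assert (HmuS : forall k, 0 <= mu + INR (S k))
  by (intros k; assert (H := pos_INR k); rewrite S_INR; lra).
destruct (Rtotal_order mu 0) as [Hm|[Hm|Hm]].
- assert (Hal : forall k, alpha (S k) <= 0).
  { induction k as [|k IH]; rewrite Hnext; assert (Hi := HinvS); unfold Rdiv.
    - rewrite H0; simpl; lra.
    - specialize (Hi (S k)); assert (H := HmuS k).
      assert ((mu + INR (S k)) * alpha (S k) <= 0) by nra.
      nra. }
  apply subordinate_Cpoly_neg; auto.
  + intros [|k] Hk; [lia|]; unfold d.
    assert (H1 := Hal k); assert (H2 := Hlam (S k)); nra.
  + intros k _; rewrite Hode; assert (H := Hdecr k).
    destruct k as [|k].
    * rewrite H0; simpl INR; nra.
    * assert ((mu + INR (S k)) * alpha (S k) <= 0)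
        by (assert (H1 := Hal k); assert (H2 := HmuS k); nra).
      nra.
- subst mu.
  assert (Hal : forall k, alpha (S k) = 0).
  { induction k as [|k IH]; rewrite Hnext; [simpl; field|rewrite IH; field].
    apply not_0_INR; lia. }
  exists (fun _ => RtoC 0).
  assert (Hin : in_disk (RtoC 0)) by (unfold in_disk; rewrite Cmod_0; lra).
  assert (Hp0 : forall w, Cpower w 0 = RtoC 1).
  { intros w; unfold Cpower; rewrite Cmult_0_l; apply Cexp_0. }
  split; [|split; [|split]].
  + intros z _; eexists; apply is_Cderive_const.
  + auto.
  + intros z _; rewrite Cmod_0; apply Cmod_ge_0.
  + intros z _; rewrite !Hp0, Cmult_1_l.
    assert (HR : forall m, Cpoly d m z = RtoC 1); [|apply HR].
    induction m as [|m IH]; [now rewrite Cpoly_0, Hd0|].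
    rewrite Cpoly_S, IH; unfold d at 1; rewrite Hal, Rmult_0_r; ring.
- assert (Hal : forall k, 0 <= alpha k).
  { induction k as [|k IH]; [lra|].
    rewrite Hnext; apply Rmult_le_pos; [|apply Rlt_le, HinvS].
    apply Rmult_le_pos; [|exact IH].
    assert (H := pos_INR k); lra. }
  apply subordinate_Cpoly_pos; auto.
  + lra.
  + intros k _; apply Rmult_le_pos; auto.
  + intros k _; rewrite Hode; repeat apply Rmult_le_pos; auto.
    assert (H := pos_INR k); lra.
Qed.
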